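(* (i) Let $(A,\star,D)$ be an algebra over $F$ with a derivation $D$ that satisfies, for all $a,b,c\in A$, the identity $$3(a,b,c)=(a\star c)\star b +(b \star c)\star a - (b \star a)\star c - (c\star a)\star b+4(a\cdot b ) \cdot D(c)+2D(a)\cdot (b\cdot c),\qquad ( * )$$ where $(a,b,c)=(a\star b)\star c-a\star (b\star c)$ and $a\cdot b=\frac{1}{2}(a\star b+b\star a)$. Then its polarization $(A,\cdot,[\,,],D)$ is a generalized Poisson algebra. (ii) Conversely, if $(A,\cdot,[\,,],D)$ is a generalized Poisson algebra, then its depolarization $(A,\star,D)$ satisfies the identity $( * )$.
   Context: The base field $F$ is algebraically closed of characteristic $0$. Algebras are vector spaces with a bilinear product, not assumed associative or unital. A derivation of an algebra is a linear map satisfying the Leibniz (product) rule with respect to its multiplication. The polarization of $(A,\star,D)$ is $(A,\cdot,[\,,],D)$, where $a\cdot b=\frac12(a\star b+b\star a)$ and $[a,b]=\frac12(a\star b-b\star a)$. The depolarization of $(A,\cdot,[\,,],D)$, where $\cdot$ is commutative and $[\,,]$ is skew-symmetric, is $(A,\star,D)$ with $a\star b=a\cdot b+[a,b]$. $(A,\cdot,[\,,],D)$ is a generalized Poisson algebra if $(A,\cdot)$ is a commutative associative algebra, $(A,[\,,])$ is a Lie algebra, $D$ is a derivation of both $(A,\cdot)$ and $(A,[\,,])$, and for all $a,b,c\in A$ $$[a \cdot b, c] = a\cdot [b, c]+[a, c]\cdot b + a\cdot b\cdot D(c).$$ *)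

(* Defs.v *)
From mathcomp Require Import all_boot all_order all_algebra.

Set Implicit Arguments.
Unset Strict Implicit.
Unset Printing Implicit Defensive.

Import GRing.Theory.
Local Open Scope ring_scope.

Section Algebras.
Variables (F : fieldType) (A : lmodType F).
Implicit Types (mul br star : A -> A -> A) (D : A -> A).

Definition bilinear_product mul : Prop :=
  (forall b, linear (mul^~ b)) /\ (forall a, linear (mul a)).

Definition derivation mul D : Prop :=
  linear D /\ (forall a b, D (mul a b) = mul (D a) b + mul a (D b)).

Definition comm_assoc_algebra mul : Prop :=
  [/\ bilinear_product mul, commutative mul & associative mul].

(* In characteristic different from 2, skew-symmetry is the same as
   [a, a] = 0 for all a. *)
Definition lie_algebra br : Prop :=
  [/\ bilinear_product br,
      forall a b, br a b = - br b a &
      forall a b c, br (br a b) c + br (br b c) a + br (br c a) b = 0].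

Definition generalized_Poisson_algebra mul br D : Prop :=
  [/\ comm_assoc_algebra mul,
      lie_algebra br,
      derivation mul D,
      derivation br D &
      forall a b c,
        br (mul a b) c =
        mul a (br b c) + mul (br a c) b + mul (mul a b) (D c)].

Definition polar_mul star : A -> A -> A :=
  fun a b => 2^-1 *: (star a b + star b a).

Definition polar_bracket star : A -> A -> A :=
  fun a b => 2^-1 *: (star a b - star b a).

Definition depolarization mul br : A -> A -> A :=
  fun a b => mul a b + br a b.

Definition associator star (a b c : A) : A :=
  star (star a b) c - star a (star b c).

Definition depolarized_identity star D : Prop :=
  forall a b c : A,
    3 *: associator star a b c =
      star (star a c) b + star (star b c) a
      - star (star b a) c - star (star c a) b
      + 4 *: polar_mul star (polar_mul star a b) (D c)
      + 2 *: polar_mul star (D a) (polar_mul star b c).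

End Algebras.

(* Main.v *)
Require Import Defs.
From mathcomp Require Import all_boot all_order all_algebra.

(** Write [a * b = a.b + [a,b]] with [.] commutative and [[,]] skew-symmetric,
    and measure the failure of the axioms of a generalized Poisson algebra by
    three defects: the associator [A(a,b,c)] of [.], the defect
    [L(a,b,c)] of the twisted Leibniz rule for [[a.b, c]], and the Jacobi sum
    [J(a,b,c)].  By bilinearity alone, the left-hand side minus the
    right-hand side of the identity at [(a,b,c)] equals
      [4 A(a,b,c) + 4 L(a,b,c) + 2 L(b,c,a) + 2 J(a,b,c)]
    ([identity_defectE]).  The converse direction is then immediate: all
    defects vanish.

    For the direct implication, the defects are separated by their symmetries.
    Under the exchange of [a] and [c], [A] and [J] change sign while [L(a,b,c)]
    and [L(b,c,a)] are swapped, [L] being symmetric in its first two arguments;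
    adding the identity at [(a,b,c)] and at [(c,b,a)] leaves
    [6 (L(a,b,c) + L(b,c,a)) = 0].  So the three values of [L] at the cyclic
    rotations of [(a,b,c)] add up to zero in pairs, and all vanish
    ([leibniz_defect_eq0]).  What remains is [2 A + J = 0]; the cyclic sum of
    [A] is zero by commutativity whereas [J] is invariant under rotation, whence
    [3 J = 0] ([jacobi_sum_eq0]) and then [A = 0] ([associator_eq0]).
    That [D] is a derivation of both polarized products is inherited from [*]
    by linearity. *)

Set Implicit Arguments.
Unset Strict Implicit.
Unset Printing Implicit Defensive.

Import GRing.Theory.
Local Open Scope ring_scope.

(** * Deciding identities between signed sums in an abelian group *)

Section SignedSums.

Inductive signed_sum : Type :=
  | SVar of nat
  | SZero
  | SAdd of signed_sum & signed_sum
  | SOpp of signed_sum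
  | SMuln of signed_sum & nat.

Fixpoint sum_eval (V : zmodType) (env : seq V) (e : signed_sum) : V :=
  match e with
  | SVar i => env`_i
  | SZero => 0
  | SAdd e1 e2 => sum_eval env e1 + sum_eval env e2
  | SOpp e1 => - sum_eval env e1
  | SMuln e1 n => sum_eval env e1 *+ n
  end.

(** The two lists hold the variables that occur positively and negatively,
    repeated according to multiplicity. *)
Fixpoint sum_parts (e : signed_sum) : seq nat * seq nat :=
  match e with
  | SVar i => ([:: i], [::])
  | SZero => ([::], [::])
  | SAdd e1 e2 => let: (p1, n1) := sum_parts e1 in
                  let: (p2, n2) := sum_parts e2 in (p1 ++ p2, n1 ++ n2)
  | SOpp e1 => let: (p, n) := sum_parts e1 in (n, p)
  | SMuln e1 k => let: (p, n) := sum_parts e1 in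
                  (flatten (nseq k p), flatten (nseq k n))
  end.

Lemma sum_flatten_nseq (V : zmodType) (f : nat -> V) (s : seq nat) k :
  \sum_(i <- flatten (nseq k s)) f i = (\sum_(i <- s) f i) *+ k.
Proof.
by elim: k => [|k IHk]; rewrite ?big_nil ?mulr0n //= big_cat /= IHk mulrS.
Qed.

Lemma sum_evalE (V : zmodType) (env : seq V) (e : signed_sum) :
  sum_eval env e = \sum_(i <- (sum_parts e).1) env`_i
                   - \sum_(i <- (sum_parts e).2) env`_i.
Proof.
elim: e => [i||e1 IH1 e2 IH2|e IH|e IH k] /=.
- by rewrite big_seq1 big_nil subr0.
- by rewrite big_nil subr0.
- rewrite IH1 IH2; case: (sum_parts e1) (sum_parts e2) => [p1 n1] [p2 n2] /=.
  by rewrite !big_cat opprD addrACA.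
- by rewrite IH; case: (sum_parts e) => [p n] /=; rewrite opprB.
- rewrite IH; case: (sum_parts e) => [p n] /=.
  by rewrite !sum_flatten_nseq mulrnBl.
Qed.

Lemma sum_eval_eq (V : zmodType) (env : seq V) (e1 e2 : signed_sum) :
  perm_eq ((sum_parts e1).1 ++ (sum_parts e2).2)
          ((sum_parts e2).1 ++ (sum_parts e1).2) ->
  sum_eval env e1 = sum_eval env e2.
Proof.
move=> e12; rewrite !sum_evalE; apply/eqP.
rewrite subr_eq addrAC eq_sym subr_eq -!big_cat eq_sym /=.
by rewrite (perm_big _ e12).
Qed.

End SignedSums.

Ltac index_in x env :=
  lazymatch env with
  | x :: _ => constr:(0%N)
  | _ :: ?env' => let i := index_in x env' in constr:(i.+1)
  end.

Ltac add_atom x env :=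
  let rec mem env0 :=
    lazymatch env0 with
    | x :: _ => env
    | _ :: ?env' => mem env'
    | _ => constr:(x :: env)
    end in mem env.

Ltac add_atoms t env :=
  lazymatch t with
  | GRing.zero => env
  | GRing.add ?u ?v => let env' := add_atoms u env in add_atoms v env'
  | GRing.opp ?u => add_atoms u env
  | GRing.natmul ?u _ => add_atoms u env
  | _ => add_atom t env
  end.

Ltac reify t env :=
  lazymatch t with
  | GRing.zero => constr:(SZero)
  | GRing.add ?u ?v =>
      let e := reify u env in let f := reify v env in constr:(SAdd e f)
  | GRing.opp ?u => let e := reify u env in constr:(SOpp e)
  | GRing.natmul ?u ?n => let e := reify u env in constr:(SMuln e n)
  | _ => let i := index_in t env in constr:(SVar i)
  end.

(** Closes an equation between sums, opposites and numeral multiples of atoms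
    that holds in every abelian group; scalings by numerals count as
    multiples. *)
Ltac abelian :=
  rewrite ?scaler_nat;
  lazymatch goal with
  | |- @eq ?T ?l ?r =>
    let env := add_atoms l (@nil T) in
    let env := add_atoms r env in
    let e := reify l env in
    let f := reify r env in
    apply: (@sum_eval_eq _ env e f); vm_compute; reflexivity
  end.

(** * The defects of a generalized Poisson algebra *)

Section Defects.
Variables (F : fieldType) (A : lmodType F).
Implicit Types (mul br star : A -> A -> A) (D : A -> A).

Definition leibniz_defect mul br D (a b c : A) : A :=
  br (mul a b) c
  - (mul a (br b c) + mul (br a c) b + mul (mul a b) (D c)).

Definition jacobi_sum br (a b c : A) : A :=
  br (br a b) c + br (br b c) a + br (br c a) b.

Definition identity_defect star D (a b c : A) : A :=
  3 *: associator star a b c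
  - (star (star a c) b + star (star b c) a
     - star (star b a) c - star (star c a) b
     + 4 *: polar_mul star (polar_mul star a b) (D c)
     + 2 *: polar_mul star (D a) (polar_mul star b c)).

Section Bilinear.
Variable f : A -> A -> A.
Hypothesis f_bilin : bilinear_product f.

Lemma bilinDl a a' b : f (a + a') b = f a b + f a' b.
Proof. by have := f_bilin.1 b 1 a a'; rewrite !scale1r. Qed.

Lemma bilinDr a b b' : f a (b + b') = f a b + f a b'.
Proof. by have := f_bilin.2 a 1 b b'; rewrite !scale1r. Qed.

Lemma bilin0l b : f 0 b = 0.
Proof. by apply/(addIr (f 0 b)); rewrite -bilinDl !add0r. Qed.

Lemma bilin0r a : f a 0 = 0.
Proof. by apply/(addIr (f a 0)); rewrite -bilinDr !add0r. Qed.

Lemma bilinNl a b : f (- a) b = - f a b.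
Proof.
by apply/eqP; rewrite -addr_eq0 -bilinDl addNr bilin0l.
Qed.

Lemma bilinNr a b : f a (- b) = - f a b.
Proof.
by apply/eqP; rewrite -addr_eq0 -bilinDr addNr bilin0r.
Qed.

Lemma bilinZl k a b : f (k *: a) b = k *: f a b.
Proof.
by have := f_bilin.1 b k a 0; rewrite !addr0 bilin0l addr0.
Qed.

Lemma bilinZr k a b : f a (k *: b) = k *: f a b.
Proof.
by have := f_bilin.2 a k b 0; rewrite !addr0 bilin0r addr0.
Qed.

End Bilinear.

(** * Polarization and depolarization *)

Hypothesis F_char0 : [pchar F] =i pred0.

Lemma natf_neq0 n : (n.+1%:R : F) != 0.
Proof. by have /pcharf0P-> := F_char0. Qed.

Lemma mulrn_torsion_free (x : A) n : x *+ n.+1 = 0 -> x = 0.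
Proof.
move=> /eqP; rewrite -scaler_nat scaler_eq0 (negPf (natf_neq0 n)) /=.
by move/eqP.
Qed.

Lemma half_double (x : A) : 2^-1 *: (x *+ 2) = x.
Proof. by rewrite -scaler_nat scalerA mulVf ?scale1r ?natf_neq0. Qed.

Lemma polar_mul_depolarization mul br :
  commutative mul -> (forall a b, br a b = - br b a) ->
  forall a b, polar_mul (depolarization mul br) a b = mul a b.
Proof.
move=> mulC brC a b; rewrite /polar_mul /depolarization (mulC b) (brC b).
by rewrite -[RHS]half_double; congr (_ *: _); abelian.
Qed.

Lemma depolarization_polar star a b :
  depolarization (polar_mul star) (polar_bracket star) a b = star a b.
Proof.
rewrite /depolarization /polar_mul /polar_bracket -scalerDr.
by rewrite -[RHS]half_double; congr (_ *: _); abelian.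
Qed.

Lemma polar_mulC star : commutative (polar_mul star).
Proof. by move=> a b; rewrite /polar_mul addrC. Qed.

Lemma polar_bracketC star a b :
  polar_bracket star a b = - polar_bracket star b a.
Proof. by rewrite /polar_bracket -scalerN opprB. Qed.

Section PolarOfBilinear.
Variable star : A -> A -> A.
Hypothesis star_bilin : bilinear_product star.

Lemma polar_mul_bilinear : bilinear_product (polar_mul star).
Proof.
suff lin a : linear (polar_mul star a).
  by split=> // b k u v; rewrite /= ![polar_mul star _ b]polar_mulC lin.
move=> k u v; rewrite /polar_mul.
rewrite !(bilinDl star_bilin, bilinDr star_bilin,
          bilinZl star_bilin, bilinZr star_bilin).
rewrite scalerA (mulrC k) -scalerA -[RHS]scalerDr [k *: (_ + _)]scalerDr.
by congr (_ *: _); abelian.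
Qed.

Lemma polar_bracket_bilinear : bilinear_product (polar_bracket star).
Proof.
suff lin a : linear (polar_bracket star a).
  split=> // b k u v; rewrite /= ![polar_bracket star _ b]polar_bracketC lin.
  by rewrite opprD scalerN.
move=> k u v; rewrite /polar_bracket.
rewrite !(bilinDl star_bilin, bilinDr star_bilin,
          bilinZl star_bilin, bilinZr star_bilin).
rewrite scalerA (mulrC k) -scalerA -[RHS]scalerDr [k *: (_ - _)]scalerBr.
by congr (_ *: _); abelian.
Qed.

Variable D : A -> A.
Hypothesis D_der : derivation star D.

Lemma derivation_linear_parts :
  [/\ {morph D : x y / x + y}, {morph D : x / - x} &
      forall k, {morph D : x / k *: x}].
Proof.
have [D_lin _] := D_der.
have DD : {morph D : x y / x + y}.
  by move=> x y; have := D_lin 1 x y; rewrite !scale1r.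
have D0 : D 0 = 0 by apply/(addIr (D 0)); rewrite -DD !add0r.
split=> // [x|k x]; last by have := D_lin k x 0; rewrite !addr0 D0 addr0.
by apply/eqP; rewrite -addr_eq0 -DD addNr D0.
Qed.

Lemma derivation_polar_mul : derivation (polar_mul star) D.
Proof.
have [DD _ DZ] := derivation_linear_parts; case: D_der => D_lin D_leib.
split=> // a b; rewrite /polar_mul DZ DD !D_leib -scalerDr.
by congr (_ *: _); abelian.
Qed.

Lemma derivation_polar_bracket : derivation (polar_bracket star) D.
Proof.
have [DD DN DZ] := derivation_linear_parts; case: D_der => D_lin D_leib.
split=> // a b; rewrite /polar_bracket DZ DD DN !D_leib -scalerDr.
by congr (_ *: _); abelian.
Qed.

End PolarOfBilinear.

(** * The identity as a combination of the defects *)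

Section CommutativeAndSkew.
Variables (mul br : A -> A -> A) (D : A -> A).
Hypotheses (mul_bilin : bilinear_product mul) (mulC : commutative mul).
Hypotheses (br_bilin : bilinear_product br).
Hypothesis brC : forall a b, br a b = - br b a.

(** On the left of the identity, [3 (a,b,c)] contributes [3 L(a,b,c) + 3 L(b,c,a)],
    and moving the right-hand side over adds [L(a,b,c) - L(b,c,a)].  The terms
    with [D] in these multiples of [L] are exactly those that the identity
    prescribes. *)
Lemma identity_defectE a b c :
  identity_defect (depolarization mul br) D a b c =
  associator mul a b c *+ 4
  + leibniz_defect mul br D a b c *+ 4 + leibniz_defect mul br D b c a *+ 2
  + jacobi_sum br a b c *+ 2.
Proof.
rewrite /identity_defect !(polar_mul_depolarization mulC brC).
rewrite /associator /leibniz_defect /jacobi_sum /depolarization.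
rewrite !(bilinDl mul_bilin, bilinDr mul_bilin, bilinDl br_bilin, bilinDr br_bilin).
(* Normal form: inner factors in cyclic order for [br], outer products with
   the compound factor on the left. *)
rewrite (mulC b a) (mulC c a) (brC b a) (brC a c).
rewrite !(bilinNl mul_bilin, bilinNr mul_bilin, bilinNl br_bilin, bilinNr br_bilin).
rewrite (brC a (mul b c)) (brC a (br b c)) (mulC a (mul b c)).
rewrite (mulC a (br b c)) (mulC b (br c a)) (mulC (D a)).
abelian.
Qed.

Lemma leibniz_defectC a b c :
  leibniz_defect mul br D a b c = leibniz_defect mul br D b a c.
Proof.
rewrite /leibniz_defect (mulC b a) (mulC b (br a c)) (mulC (br b c) a).
abelian.
Qed.

Lemma associator_rev a b c : associator mul c b a = - associator mul a b c.
Proof.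
rewrite /associator (mulC c b) (mulC b a) (mulC c) (mulC a (mul b c)).
abelian.
Qed.

Lemma associator_cyclic_sum a b c :
  associator mul a b c + associator mul b c a + associator mul c a b = 0.
Proof.
rewrite /associator (mulC a (mul b c)) (mulC b (mul c a)) (mulC c (mul a b)).
abelian.
Qed.

Lemma jacobi_sum_rev a b c : jacobi_sum br c b a = - jacobi_sum br a b c.
Proof.
rewrite /jacobi_sum (brC c b) (brC b a) (brC a c) !(bilinNl br_bilin).
abelian.
Qed.

Lemma jacobi_sum_rot a b c : jacobi_sum br b c a = jacobi_sum br a b c.
Proof. rewrite /jacobi_sum; abelian. Qed.

Hypothesis defect0 :
  forall a b c, identity_defect (depolarization mul br) D a b c = 0.

(** The sum of the identities at [(x,y,z)] and [(z,y,x)] eliminates [A] and [J];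
    it makes [L] change sign under cyclic rotation, which has odd order. *)
Lemma leibniz_defect_eq0 a b c : leibniz_defect mul br D a b c = 0.
Proof.
have L_pair x y z :
    leibniz_defect mul br D x y z = - leibniz_defect mul br D y z x.
  apply/eqP; rewrite -addr_eq0; apply/eqP/(@mulrn_torsion_free _ 5).
  rewrite -[RHS](addr0 0) -{1}(defect0 x y z) -(defect0 z y x).
  rewrite !identity_defectE associator_rev jacobi_sum_rev.
  rewrite (leibniz_defectC z y) (leibniz_defectC y x).
  abelian.
apply: (@mulrn_torsion_free _ 1); apply/eqP; rewrite mulr2n addr_eq0 {1}L_pair.
by rewrite L_pair opprK L_pair.
Qed.

Lemma double_associator_jacobi a b c :
  associator mul a b c *+ 2 = - jacobi_sum br a b c.
Proof.
apply/eqP; rewrite -addr_eq0; apply/eqP/(@mulrn_torsion_free _ 1).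
rewrite -(defect0 a b c) identity_defectE !leibniz_defect_eq0.
abelian.
Qed.

(** The cyclic sum of [2 A = - J] reads [0 = - 3 J]. *)
Lemma jacobi_sum_eq0 a b c : jacobi_sum br a b c = 0.
Proof.
apply: (@mulrn_torsion_free _ 2).
transitivity (- (associator mul a b c *+ 2 + associator mul b c a *+ 2
                 + associator mul c a b *+ 2)).
  rewrite !double_associator_jacobi (jacobi_sum_rot b c a).
  by rewrite (jacobi_sum_rot a b c); abelian.
by rewrite -!mulrnDl associator_cyclic_sum mul0rn oppr0.
Qed.

Lemma associator_eq0 a b c : associator mul a b c = 0.
Proof.
apply: (@mulrn_torsion_free _ 1).
by rewrite double_associator_jacobi jacobi_sum_eq0 oppr0.
Qed.

End CommutativeAndSkew.

End Defects.

(** * Equivalence of the two presentations *)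

Theorem theorem3p1 (F : closedFieldType) (F_char0 : [pchar F] =i pred0)
    (A : lmodType F) :
  (forall (star : A -> A -> A) (D : A -> A),
     bilinear_product star -> derivation star D ->
     depolarized_identity star D ->
     generalized_Poisson_algebra (polar_mul star) (polar_bracket star) D)
  /\
  (forall (mul br : A -> A -> A) (D : A -> A),
     generalized_Poisson_algebra mul br D ->
     depolarized_identity (depolarization mul br) D).
Proof.
split=> [star D star_bilin D_der star_id | mul br D].
  have mul_bilin := polar_mul_bilinear star_bilin.
  have br_bilin := polar_bracket_bilinear star_bilin.
  have mulC := polar_mulC star.
  have brC := polar_bracketC star.
  have defect0 a b c :
      identity_defect (depolarization (polar_mul star) (polar_bracket star))
        D a b c = 0.
    rewrite /identity_defect !(polar_mul_depolarization F_char0 mulC brC).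
    rewrite /associator !(depolarization_polar F_char0).
    by apply/eqP; rewrite subr_eq0 -star_id.
  split; [split=> // a b c | split=> // a b c | exact: derivation_polar_mul
         | exact: derivation_polar_bracket | move=> a b c].
  - apply/esym/eqP; rewrite -subr_eq0; apply/eqP.
    exact: (associator_eq0 F_char0 mul_bilin mulC br_bilin brC defect0).
  - exact: (jacobi_sum_eq0 F_char0 mul_bilin mulC br_bilin brC defect0).
  - apply/eqP; rewrite -subr_eq0; apply/eqP.
    exact: (leibniz_defect_eq0 F_char0 mul_bilin mulC br_bilin brC defect0).
case=> [[mul_bilin mulC mulA] [br_bilin brC jacobi] _ _ leibniz] a b c.
apply/eqP; rewrite -subr_eq0 -/(identity_defect _ _ _ _ _).
rewrite (identity_defectE F_char0 D mul_bilin mulC br_bilin brC).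
rewrite /leibniz_defect /associator /jacobi_sum.
by rewrite !leibniz jacobi mulA !subrr !mul0rn !addr0.
Qed.
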